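(* A subset $C$ of $E$ is max-plus convex if and only if it is geodesically convex with respect to the geodesic structure $\Gamma_{\mathbf{u}}$.
   Context: $E\neq\{0\}$ is an Archimedean Riesz space (real vector lattice; Archimedean means that if $ny\leqslant x$ for all $n\in\mathbb{N}$ then $y\leqslant 0$), and $\mathbf{u}\in E_+$ is a unit: for every $x\in E_+$ there is $n\in\mathbb{N}$ with $x\leqslant n\mathbf{u}$. The max-plus convex hull of a nonempty $S\subset E$ is the set $[\![S]\!]$ of all elements $(x_1+t_1\mathbf{u})\vee\cdots\vee(x_m+t_m\mathbf{u})$ with $m\ge1$, $x_i\in S$, $t_i\in\mathbb{R}$ and $\max_i t_i=0$; $[\![\emptyset]\!]=\emptyset$. A set $C\subset E$ is max-plus convex if $C=[\![C]\!]$. Let $\mathbf{p}_{\mathbf{u}}(x)=\inf\{t\in\mathbb{R}:x\leqslant t\mathbf{u}\}$, $\mathbf{q}_{\mathbf{u}}(x)=\sup\{t\in\mathbb{R}:t\mathbf{u}\leqslant x\}$, $\alpha_{\mathbf{u}}(x_1,x_2)=\min\{0,\mathbf{q}_{\mathbf{u}}(x_1-x_2)\}$, $\beta_{\mathbf{u}}(x_1,x_2)=\max\{0,\mathbf{p}_{\mathbf{u}}(x_1-x_2)\}$. The geodesic structure $\Gamma_{\mathbf{u}}$ on $E$, equipped with the metric $\mathsf{D}_{\mathbf{hu}}(x,y)=\max\{0,\mathbf{p}_{\mathbf{u}}(x-y)\}+\max\{0,\mathbf{p}_{\mathbf{u}}(y-x)\}$, assigns to each $(x_1,x_2)\in E\times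 E$ the map $\gamma_{\mathbf{u}}(x_1,x_2,\cdot):[\alpha_{\mathbf{u}}(x_1,x_2),\beta_{\mathbf{u}}(x_1,x_2)]\to E$, $\gamma_{\mathbf{u}}(x_1,x_2,t)=x_1\vee(x_2+t\mathbf{u})$ for $t\le0$ and $(x_1-t\mathbf{u})\vee x_2$ for $t\geq0$. A set $C\subset E$ is geodesically convex with respect to $\Gamma_{\mathbf{u}}$ if for all $x_1,x_2\in C$ the image of $\gamma_{\mathbf{u}}(x_1,x_2,\cdot)$ is contained in $C$ (the empty set is convex). *)

(* Defs.v *)
From HB Require Import structures.
From mathcomp Require Import all_boot all_order all_algebra.
From mathcomp Require Import mathcomp_extra boolp classical_sets set_interval reals.

Set Implicit Arguments.
Unset Strict Implicit.
Unset Printing Implicit Defensive.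

Import Order.TTheory GRing.Theory Num.Theory.

Local Open Scope classical_set_scope.
Local Open Scope ring_scope.

(* Real vector lattices.  The meet and join are declared in the mixin, and the
   library lattice instance below, because an HB structure extending both
   [GRing.Zmodule] and [Order.Lattice ring_display] can only be declared before
   [Num.RealDomain].  [ring_display] makes [<=] in [ring_scope] the order of
   the space. *)
HB.mixin Record Lmodule_POrder_isRiesz (R : realType) E
    of GRing.Lmodule R E & Order.POrder ring_display E := {
  riesz_lerD2r : forall x y z : E, x <= y -> x + z <= y + z;
  riesz_scaler_ge0 : forall (a : R) (x : E), 0 <= a -> 0 <= x -> 0 <= a *: x;
  riesz_meet : E -> E -> E;
  riesz_join : E -> E -> E;
  riesz_lexI : forall x y z : E,
    (x <= riesz_meet y z) = (x <= y) && (x <= z);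
  riesz_leUx : forall x y z : E,
    (riesz_join x y <= z) = (x <= z) && (y <= z)
}.

#[short(type="rieszType")]
HB.structure Definition Riesz (R : realType) :=
  { E of GRing.Lmodule R E & Order.POrder ring_display E
       & Lmodule_POrder_isRiesz R E }.

#[non_forgetful_inheritance]
HB.instance Definition _ (R : realType) (E : rieszType R) :=
  Order.POrder_isMeetSemilattice.Build ring_display (Riesz.sort E)
    (@riesz_lexI R E).
#[non_forgetful_inheritance]
HB.instance Definition _ (R : realType) (E : rieszType R) :=
  Order.POrder_isJoinSemilattice.Build ring_display (Riesz.sort E)
    (@riesz_leUx R E).

Section MaxPlus.
Context {R : realType} {E : rieszType R}.
Implicit Types (u x y : E) (S C : set E).

Definition order_unit u : Prop :=
  0 <= u /\ forall x, 0 <= x -> exists n : nat, x <= u *+ n.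

(* The iterated max and join are taken over a nonempty family, so they start
   from the term of index 0 (a duplicate, both operations being idempotent).
   The hull of the empty set is empty, as there is then no family [x]. *)
Definition maxplus_hull u S : set E :=
  [set y | exists (m : nat) (x : 'I_m.+1 -> E) (t : 'I_m.+1 -> R),
     [/\ forall i, S (x i),
         \big[Num.max/t ord0]_(i < m.+1) t i = 0
       & y = \big[Order.join/x ord0 + t ord0 *: u]_(i < m.+1)
               (x i + t i *: u)]].

Definition maxplus_convex u C : Prop := C = maxplus_hull u C.

Definition p_ u x : R := inf [set t : R | x <= t *: u].
Definition q_ u x : R := sup [set t : R | t *: u <= x].

Definition alpha_ u x1 x2 : R := Num.min 0 (q_ u (x1 - x2)).
Definition beta_ u x1 x2 : R := Num.max 0 (p_ u (x1 - x2)).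

End MaxPlus.

Definition archimedean_riesz (R : realType) (E : rieszType R) : Prop :=
  forall x y : E, (forall n : nat, y *+ n <= x) -> y <= 0.

(* A path [geo_lo x1 x2, geo_hi x1 x2] -> T for each pair of points; the values of
   [geo_path x1 x2] outside of that interval are irrelevant.  Only this family of
   paths, and not the metric making them geodesics, enters in the notion of
   convexity. *)
Record geodesic_structure (R : realType) (T : Type) := GeodesicStructure {
  geo_lo : T -> T -> R;
  geo_hi : T -> T -> R;
  geo_path : T -> T -> R -> T
}.

Definition geodesically_convex (R : realType) (T : Type)
    (G : geodesic_structure R T) (C : set T) : Prop :=
  forall x1 x2 : T, C x1 -> C x2 ->
    geo_path G x1 x2 @` `[geo_lo G x1 x2, geo_hi G x1 x2] `<=` C.

Definition gamma_ (R : realType) (E : rieszType R) (u x1 x2 : E) (t : R) : E :=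
  if t <= 0 then Order.join x1 (x2 + t *: u) else Order.join (x1 - t *: u) x2.

Definition Gamma_ (R : realType) (E : rieszType R) (u : E) :
    geodesic_structure R E :=
  GeodesicStructure (alpha_ u) (beta_ u) (gamma_ u).

(* Main.v *)
Require Import Defs.
From mathcomp Require Import all_boot all_order all_algebra.
From mathcomp Require Import boolp classical_sets reals.
Import Order.TTheory GRing.Theory Num.Theory.
Local Open Scope classical_set_scope.
Local Open Scope ring_scope.

(** Both notions of convexity come down to one binary closure property: if
    [x1] and [x2] belong to [C] and [t <= 0], then [x1 \/ (x2 + t u)] belongs
    to [C].

    The binary property is the two-term case of the max-plus hull, and
    conversely it generates the whole hull ([stable_hull]): one of the
    coefficients vanishes, so one of the points enters the join untranslated
    and the others can be absorbed into it one after the other.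

    Both halves of the path [gamma_u(x1, x2, .)] have the binary form, up to
    exchanging [x1] and [x2] for [t >= 0].  Conversely, geodesic convexity gives
    the property only for [alpha_u(x1, x2) <= t <= 0], but below
    [alpha_u(x1, x2)] the path is constant: [t < q_u(x1 - x2)] forces
    [x2 + t u <= x1], so that the join is [x1] ([join_lt_alpha]).  The order
    unit ensures that the supremum defining [q_u] is over a nonempty set. *)

Section MaxPlusConvexity.
Set Implicit Arguments.
Unset Strict Implicit.
Context {R : realType} {E : rieszType R}.
Implicit Types (u x y z : E) (C : set E) (t : R).

Lemma riesz_subr_ge0 x y : (0 <= y - x) = (x <= y).
Proof.
apply/idP/idP => /(@riesz_lerD2r R E) h.
  by have := h x; rewrite add0r subrK.
by have := h (- x); rewrite subrr.
Qed.

Lemma riesz_scaler_le u s t : 0 <= u -> s <= t -> s *: u <= t *: u.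
Proof.
move=> u0 st; rewrite -riesz_subr_ge0 -scalerBl.
by apply: riesz_scaler_ge0; rewrite ?subr_ge0.
Qed.

Lemma order_unit_minorant u x : order_unit u -> exists t, t *: u <= x.
Proof.
move=> [u0 uP].
(* The unit only dominates positive elements, hence the positive part of [- x]. *)
have [n nP] := uP (Order.join (0 : E) (- x)) (leUl _ _).
exists (- n%:R); rewrite -riesz_subr_ge0 scaleNr opprK scaler_nat addrC.
rewrite -[x in _ + x]opprK riesz_subr_ge0.
exact: le_trans (leUr _ _) nP.
Qed.

(** Some [s > t] satisfies [s u <= x - y], whence [y + t u <= y + s u <= x].
    If the set of the [s] with [s u <= x - y] is bounded above, this holds
    because [t] is less than its supremum [q_ u (x - y)]; if it is not, [sup] is
    the default value [0], but the set then has elements above any [t]. *)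
Lemma join_lt_alpha u x y t : order_unit u -> t < alpha_ u x y ->
  Order.join x (y + t *: u) = x.
Proof.
move=> hu; rewrite /alpha_ lt_min => /andP[_ tq].
have [u0 _] := hu.
have [s0 s0P] := order_unit_minorant (x - y) hu.
suff [s sP ts] : exists2 s, s *: u <= x - y & t < s.
  apply/join_idPl; rewrite -riesz_subr_ge0 opprD addrA riesz_subr_ge0.
  exact: le_trans (riesz_scaler_le u0 (ltW ts)) sP.
have [ub|nub] := pselect (has_ubound [set s : R | s *: u <= x - y]).
  by have [s sP ts] := sup_gt (ex_intro _ s0 s0P) tq; exists s.
apply: contrapT => none; apply: nub; exists t => s /= sP.
by rewrite leNgt; apply/negP => ts; apply: none; exists s.
Qed.

(** Translating only one of the two points loses nothing: when the maximum of
    two coefficients is [0], one of them is [0] and the other is nonpositive. *)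
Definition maxplus_stable u C : Prop :=
  forall x y t, C x -> C y -> t <= 0 -> C (Order.join x (y + t *: u)).

Lemma maxplus_hull2 u C x y t : C x -> C y -> t <= 0 ->
  maxplus_hull u C (Order.join x (y + t *: u)).
Proof.
move=> Cx Cy t0.
exists 1, (fun i => if i == ord0 then x else y),
  (fun i => if i == ord0 then 0 else t); split=> [i||].
- by case: ifP.
- by rewrite !big_ord_recl big_ord0 /= (max_r t0) maxxx.
- by rewrite !big_ord_recl big_ord0 /= scale0r addr0 joinCA joinxx joinC.
Qed.

Lemma le_bigjoin (I : eqType) (r : seq I) (F : I -> E) z (i : I) :
  i \in r -> F i <= \big[Order.join/z]_(j <- r) F j.
Proof.
elim: r => // j r IHr; rewrite inE big_cons => /predU1P[->|/IHr h].
  exact: leUl.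
exact: le_trans h (leUr _ _).
Qed.

Lemma bigmax_attained (m : nat) (t : 'I_m.+1 -> R) :
  exists i, \big[Num.max/t ord0]_(j < m.+1) t j = t i.
Proof.
apply: (big_ind (fun a => exists i, a = t i)) => [|a b [i ->] [j ->]|i _].
- by exists ord0.
- by case: (leP (t i) (t j)) => _; [exists j|exists i].
- by exists i.
Qed.

(** Starting from the point [x k] whose coefficient is the maximum [0], each
    join with a term [x i + t i u] is an instance of stability, as [t i <= 0]. *)
Lemma stable_hull u C : maxplus_stable u C -> maxplus_hull u C `<=` C.
Proof.
move=> Cst y [m [x [t [Cx tmax ->]]]].
have t_le0 i : t i <= 0.
  rewrite -tmax; elim: (index_enum _) (mem_index_enum i) => // j r IHr.
  rewrite inE big_cons le_max => /predU1P[->|/IHr ->]; first by rewrite lexx.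
  by rewrite orbT.
have [k tk] := bigmax_attained t.
have xkE : x k + t k *: u = x k by rewrite -tk tmax scale0r addr0.
set s := \big[_/_]_(i < _) _.
(* The partial joins need not lie in [C], but their joins with [x k] do. *)
have : C (Order.join (x k) s).
  apply: (big_rec (fun y => C (Order.join (x k) y))) => [|i z _ Cz].
    exact: Cst.
  by rewrite joinCA joinC; apply: Cst.
have -> // : Order.join (x k) s = s.
apply/join_idPr; rewrite -xkE.
exact: (le_bigjoin (fun i => x i + t i *: u) _ (mem_index_enum k)).
Qed.

Lemma maxplus_convexP u C : maxplus_convex u C <-> maxplus_stable u C.
Proof.
split=> [CE x y t Cx Cy t0|Cst].
  by rewrite CE; apply: maxplus_hull2.
apply/seteqP; split; last exact: stable_hull.
by move=> x Cx; rewrite -[x](joinxx x) -{2}[x]addr0 -(scale0r u);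
  apply: maxplus_hull2.
Qed.

Lemma geodesically_convexP u C : order_unit u ->
  geodesically_convex (Gamma_ u) C <-> maxplus_stable u C.
Proof.
move=> hu; split=> [Cg x y t Cx Cy t0|Cst x y Cx Cy _ [t _ <-]] /=.
  have [tlt|tge] := ltP t (alpha_ u x y); first by rewrite join_lt_alpha.
  apply: (Cg x y Cx Cy); exists t; last by rewrite /= /gamma_ t0.
  by rewrite /= in_itv /= tge (le_trans t0) // /beta_ le_max lexx.
rewrite /gamma_; case: ifPn => [|]; first exact: Cst.
rewrite -ltNge => /ltW t0; rewrite joinC -scaleNr.
by apply: Cst; rewrite ?oppr_le0.
Qed.

End MaxPlusConvexity.

Theorem corollary2 (R : realType) (E : rieszType R)
    (E_neq0 : exists x : E, x != 0)
    (E_arch : archimedean_riesz E)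
    (u : E) (u_unit : order_unit u)
    (C : set E) :
  maxplus_convex u C <-> geodesically_convex (Gamma_ u) C.
Proof.
by rewrite maxplus_convexP geodesically_convexP.
Qed.
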